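(* Let $k\ge2$ and let $G_1,G_2$ be undirected graphs. The following are equivalent: (i) $G_1$ and $G_2$ are distinguished by $k$-walk refinement (after some number of iterations); (ii) $G_1$ and $G_2$ are distinguished by $\mathcal{W}_k$; (iii) Spoiler has a winning strategy in the bijective $k$-walk pebble game on $G_1$ and $G_2$.
   Context: Initial coloring of $G=(V,E)$: $\chi(v,v)=-1$, $\chi(u,v)=1$ for adjacent $u\ne v$, $0$ otherwise. $k$-walk refinement: $\chi_{\mathcal{W}[k]}(u,v)=\{\!\{(\chi(u,w_1),\chi(w_1,w_2),\dots,\chi(w_{k-1},v)): w_i\in V\}\!\}$ (colors are formal objects comparable across graphs). It distinguishes $G_1,G_2$ if for some $m$ the multisets of all colors of vertex pairs after $m$ iterations from the initial colorings differ. $\mathcal{W}_k$: $k+1$ variables; formulas with free variables among $z_1,z_{k+1}$ given by $\varphi(z_1,z_{k+1})::= z_1=z_{k+1}\mid z_1\sim z_{k+1}\mid\varphi\wedge\varphi\mid\neg\varphi\mid\exists^j(z_2,\dots,z_k).\ \bigwedge_{i\in[k]}\varphi_i(z_i,z_{i+1})$ with $z_1,\dots,z_{k+1}$ pairwise distinct, the walk quantifier holding iff at least $j$ distinct tuples $(v_2,\dots,v_k)$ satisfy the conjunction; $\mathcal{W}_k$ distinguishes $G_1,G_2$ if some sentence (formula without free variables) has different truth values on them. Bijective $k$-walk pebble game: pebble pairs $(p_i,q_i)$, $i\in[k+1]$; pairs $i,i+1$ ($i\in[k]$) and $k+1,1$ are consecutive. If $|V_1|\ne|V_2|$ Spoiler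 wins immediately; otherwise all pebbles start beside the graphs. Each round: (1) if pebbles are on the graphs, Spoiler chooses a pair $(p_i,q_i)$, relabels it $(p_1,q_1)$ and relabels the next consecutive pair, if placed, $(p_{k+1},q_{k+1})$, then removes all other pairs; (2) Duplicator chooses a bijection $f\colon V_1^{k-1}\to V_2^{k-1}$; (3) Spoiler chooses $(u_2,\dots,u_k)\in V_1^{k-1}$, places $p_i$ on $u_i$ and $q_i$ on $v_i$ where $f(u_2,\dots,u_k)=(v_2,\dots,v_k)$. Spoiler wins after a round if some consecutive pebble pairs lie on $(a,b)\in V_1^2$ and $(a',b')\in V_2^2$ with $a\mapsto a',b\mapsto b'$ not an isomorphism of the induced subgraphs on $\{a,b\}$, $\{a',b'\}$. A winning strategy lets Spoiler win after finitely many rounds against every Duplicator play. *)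

(* Defs.v *)
From HB Require Import structures.
From mathcomp Require Import all_boot fingroup perm ssralg ssrint.
From mathcomp Require Import finmap multiset.

Set Implicit Arguments.
Unset Strict Implicit.
Unset Printing Implicit Defensive.

Local Open Scope mset_scope.
Local Open Scope nat_scope.

Record graph := Graph {
  vertex :> finType;
  adj : rel vertex;
  adj_sym : symmetric adj;
  adj_irrefl : irreflexive adj }.

Section WalkRefinement.
Variable k : nat.

(* The type of colors after m iterations.  It does not depend on a graph, so  *)
(* colors of different graphs are compared by plain equality.                 *)
Fixpoint color (m : nat) : choiceType :=
  if m is m'.+1 then {mset k.-tuple (color m')} else int.

Definition init_color (G : graph) (u v : G) : color 0 :=
  if u == v then (- 1)%R else if adj u v then 1%R else 0%R.

(* With w of size k.-1, the walk u, w_1, ..., w_(k-1), v has k steps; the     *)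
(* default value of nth is never reached.                                     *)
Definition walk_colors (G : graph) (m : nat) (chi : G -> G -> color m)
    (u v : G) (w : k.-1.-tuple G) : k.-tuple (color m) :=
  let s := u :: rcons w v in [tuple chi (nth u s i) (nth u s i.+1) | i < k].

Definition refine (G : graph) (m : nat) (chi : G -> G -> color m) (u v : G) :
    color m.+1 :=
  seq_mset [seq walk_colors chi u v w | w : k.-1.-tuple G].

Fixpoint walk_refinement (G : graph) (m : nat) : G -> G -> color m :=
  if m is m'.+1 then refine (@walk_refinement G m') else @init_color G.

Definition refinement_distinguishes (G1 G2 : graph) : Prop :=
  exists m : nat,
    seq_mset [seq @walk_refinement G1 m p.1 p.2 | p : G1 * G1]
    <> seq_mset [seq @walk_refinement G2 m p.1 p.2 | p : G2 * G2].

End WalkRefinement.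

Section WalkLogic.
Variable k : nat.

(* Raw syntax over the k+1 variables 'I_k.+1.  In [Walk j z phi] the pairwise *)
(* distinct variables z_1, ..., z_(k+1) are the values z 0, ..., z k of a     *)
(* permutation, and phi lists phi_1, ..., phi_k.                              *)
Inductive form : Type :=
| Eq of 'I_k.+1 & 'I_k.+1
| Adj of 'I_k.+1 & 'I_k.+1
| And of form & form
| Not of form
| Walk of nat & 'S_k.+1 & ('I_k -> form).

(* The quantified variables z_2, ..., z_k sit at the positions 0 < i < k.     *)
Definition interior (i : 'I_k.+1) : bool := 0 < i < k.

Fixpoint fv (phi : form) : {set 'I_k.+1} :=
  match phi with
  | Eq x y | Adj x y => [set x; y]
  | And psi1 psi2 => fv psi1 :|: fv psi2
  | Not psi => fv psi
  | Walk _ z psi => (\bigcup_i fv (psi i)) :\: [set z i | i in interior]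
  end.

(* Membership in the logic: a formula phi(x, y) is one whose free variables   *)
(* are among x and y.  The two variables of an atom may coincide; otherwise   *)
(* every formula would have exactly two free variables, and there would be    *)
(* no sentences.                                                              *)
Fixpoint wf (phi : form) : bool :=
  match phi with
  | Eq _ _ | Adj _ _ => true
  | And psi1 psi2 => [&& wf psi1, wf psi2 & #|fv psi1 :|: fv psi2| <= 2]
  | Not psi => wf psi
  | Walk _ z psi =>
      [forall i : 'I_k, wf (psi i) &&
        (fv (psi i) \subset [set z (widen_ord (leqnSn k) i); z (lift ord0 i)])]
  end.

Definition assignment (G : graph) := 'I_k.+1 -> option G.

Definition assign (G : graph) (a : assignment G) (z : 'S_k.+1)
    (w : k.-1.-tuple G) : assignment G :=
  fun x => let i := (z^-1)%g x in if interior i then onth w i.-1 else a x.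

(* Assignments are partial so that sentences have a truth value in the empty  *)
(* graph as well; the value of an atom with an unassigned variable is         *)
(* irrelevant for sentences.                                                  *)
Fixpoint sat (G : graph) (a : assignment G) (phi : form) : bool :=
  match phi with
  | Eq x y => if (a x, a y) is (Some u, Some v) then u == v else false
  | Adj x y => if (a x, a y) is (Some u, Some v) then adj u v else false
  | And psi1 psi2 => sat a psi1 && sat a psi2
  | Not psi => ~~ sat a psi
  | Walk j z psi =>
      j <= #|[set w : k.-1.-tuple G | [forall i, sat (assign a z w) (psi i)]]|
  end.

Definition sentence (phi : form) : bool := wf phi && (fv phi == set0).

Definition holds (G : graph) (phi : form) : bool :=
  sat (fun=> None : option G) phi.

Definition logic_distinguishes (G1 G2 : graph) : Prop :=
  exists2 phi : form, sentence phi & holds G1 phi <> holds G2 phi.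

End WalkLogic.

Section PebbleGame.
Variables (k : nat) (G1 G2 : graph).

(* The map a |-> a', b |-> b' is an isomorphism of the subgraphs induced on   *)
(* {a, b} and {a', b'}.                                                       *)
Definition pair_iso (a b : G1) (a' b' : G2) : Prop :=
  exists h : G1 -> G2,
    [/\ h a = a', h b = b', {in [set a; b] &, injective h}
      & {in [set a; b] &, {mono h : x y / adj x y >-> adj x y}}].

(* P i is the position of the pebble pair with label i, or None if that pair  *)
(* lies beside the graphs; labels 1, ..., k+1 are shifted to 0, ..., k.  The  *)
(* pair following i consecutively is ordS i, which is 0 for i = k.            *)
Definition position := 'I_k.+1 -> option (G1 * G2).

Definition relabel (P : position) (i : 'I_k.+1) : position :=
  fun l => if l == ord0 then P i else if l == ord_max then P (ordS i) else None.

Inductive relabel_move (P : position) : position -> Prop :=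
| NoPebbles : (forall i, P i = None) -> relabel_move P P
| Relabel i : isSome (P i) -> relabel_move P (relabel P i).

Definition place (P : position) (u : k.-1.-tuple G1) (v : k.-1.-tuple G2) :
    position :=
  fun l => if interior l then onth (zip u v) l.-1 else P l.

Definition spoiler_won (P : position) : Prop :=
  exists i a a' b b',
    [/\ P i = Some (a, a'), P (ordS i) = Some (b, b') & ~ pair_iso a b a' b'].

(* The positions from which Spoiler can win in finitely many rounds; reply is *)
(* Spoiler's answer to the bijection chosen by Duplicator.                    *)
Inductive spoiler_wins (P : position) : Prop :=
| Won : spoiler_won P -> spoiler_wins P
| Round P' (reply : (k.-1.-tuple G1 -> k.-1.-tuple G2) -> k.-1.-tuple G1) :
    relabel_move P P' ->
    (forall f, bijective f -> spoiler_wins (place P' (reply f) (f (reply f)))) ->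
    spoiler_wins P.

Definition spoiler_has_winning_strategy : Prop :=
  #|G1| <> #|G2| \/ spoiler_wins (fun=> None).

End PebbleGame.

(* Main.v *)
(* Two families have the same multiset of values iff a bijection of the index *)
(* types matches these values.  With such bijections, Duplicator survives as  *)
(* long as she keeps consecutive pebbles on pairs of the same stable color,   *)
(* and formulas cannot tell such pairs apart.  Conversely, Spoiler descends   *)
(* from a difference of colors at stage m + 1 to a difference at stage m on   *)
(* one step of a walk, and a color is defined by a formula that states the    *)
(* multiplicity of each tuple of walk colors.  To start without pebbles or    *)
(* free variables, two nested (k-1)-tuples are chosen of which only the heads *)
(* u and v matter; this reduces the colors of all pairs (u, v) to those of    *)
(* the pairs with a given first vertex.                                       *)

Require Import Defs.
From mathcomp Require Import all_boot fingroup perm ssralg ssrint.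
From mathcomp Require Import finmap multiset.
From Stdlib Require Import Classical.

Set Implicit Arguments.
Unset Strict Implicit.
Unset Printing Implicit Defensive.

Local Open Scope mset_scope.
Local Open Scope nat_scope.

(** Refined colors, Duplicator's bijections and the walk quantifier all compare families indexed by
    $(k-1)$-tuples, and [seq_mset_bijP] translates between them. From [Section Colors] on, the $k$
    of the theorem is [k.+2], so these tuples have length [k.+1].

    Suppose the colors of all pairs agree at every stage. By [stable_color], agreement of two pairs
    at one late stage implies agreement at all stages, so [balanced_extension] can match tuples such
    that consecutive pebbles stay on pairs of equal color. This one lemma serves as Duplicator's
    strategy ([spoiler_wins_unbalanced]) and as the bijection that preserves counts at a walk
    quantifier ([sat_balanced]).

    Suppose the colors differ at stage $m$. By [eq_head_colors] the nested multisets of $\chi(u,v)$,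
    over $v$ inside and $u$ outside, differ too. Spoiler exposes this in two rounds
    ([spoiler_wins_start]) and descends to stage 0 ([spoiler_wins_color]), where [pair_isoP] ends
    the game. The sentence [graph_form] expresses the same nested multiset. *)

(** * Multisets of values, tuples and cyclic labels *)

Lemma count_mem_image (T : finType) (C : eqType) (g : T -> C) (c : C) :
  count_mem c [seq g x | x : T] = #|[set x | g x == c]|.
Proof.
by rewrite count_map -size_filter cardsE cardE enumT [in RHS]/enum_mem.
Qed.

Lemma seq_mset_bijP (T1 T2 : finType) (C : choiceType)
    (g1 : T1 -> C) (g2 : T2 -> C) :
  seq_mset [seq g1 x | x : T1] = seq_mset [seq g2 x | x : T2] <->
  exists2 f : T1 -> T2, bijective f & forall x, g1 x = g2 (f x).
Proof.
split=> [/eq_seq_msetP perm_g|[f f_bij g1E]]; last first.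
  apply/eq_seq_msetP; rewrite /image_mem (eq_map g1E) (map_comp g2 f).
  apply/perm_map/uniq_perm; rewrite ?enum_uniq //.
    by rewrite (map_inj_uniq (bij_inj f_bij)) enum_uniq.
  case: f_bij => h _ hK y; rewrite mem_enum; apply/mapP.
  by exists (h y); rewrite ?mem_enum ?hK.
have /tuple_permP [p g1E] : perm_eq [seq g1 x | x : T1] (image_tuple g2 T2).
  by [].
have eqT : #|T1| = #|T2| by move/perm_size: perm_g; rewrite !size_image.
exists (fun x => enum_val (p (cast_ord eqT (enum_rank x)))).
  apply: inj_card_bij; last by rewrite eqT.
  by move=> x y /enum_val_inj/perm_inj/cast_ord_inj/enum_rank_inj.
move=> x; have := nth_image (g1 x) g1 (enum_rank x).
rewrite enum_rankK => {1}<-; rewrite g1E.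
rewrite -[LHS]/(nth (g1 x) _ (cast_ord eqT (enum_rank x))) -tnth_nth.
by rewrite tnth_mktuple (tnth_nth (g1 x)) nth_image.
Qed.

(** Each fibre of [thead] has $|T|^n$ elements. *)
Lemma sum_tuple_head (T : finType) (n : nat) (F : T -> nat) :
  \sum_(w : n.+1.-tuple T) F (thead w) = #|T| ^ n * \sum_x F x.
Proof.
rewrite (partition_big (fun w : n.+1.-tuple T => thead w) xpredT) //=.
rewrite big_distrr; apply: eq_bigr => x _ /=.
under eq_bigr => w /eqP -> do [].
rewrite sum_nat_const; congr (_ * _); rewrite -card_tuple.
rewrite -(card_imset (f := fun w : n.-tuple T => cons_tuple x w)).
  apply: eq_card => w; rewrite [LHS]unfold_in.
  apply/eqP/imsetP => [<-|[w' _ ->]].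
    by exists (behead_tuple w); rewrite // [LHS]tuple_eta.
  by rewrite theadE.
by move=> w w' /(congr1 val) /= [] /val_inj.
Qed.

Lemma onth_zip (S T : Type) (s : seq S) (t : seq T) i x y :
  onth s i = Some x -> onth t i = Some y -> onth (zip s t) i = Some (x, y).
Proof.
by elim: s t i => [|x' s IHs] [|y' t] [|i] //= => [[->] [->]|]; [|apply: IHs].
Qed.

(** A bijection without mismatch would make the multisets equal, so Spoiler can always answer with a
    mismatch. Equal cardinalities exclude empty index types, where there would be no default
    [x0]. *)
Lemma bijection_reply (T1 T2 : finType) (C : choiceType)
    (g1 : T1 -> C) (g2 : T2 -> C) : #|T1| = #|T2| ->
  seq_mset [seq g1 x | x : T1] <> seq_mset [seq g2 x | x : T2] ->
  exists reply : (T1 -> T2) -> T1,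
    forall f, bijective f -> g1 (reply f) <> g2 (f (reply f)).
Proof.
move=> eqT neq_g; have [x0 _|T1_0] := pickP T1; last first.
  case: neq_g; congr seq_mset; apply: (@etrans _ _ [::]).
    by apply: size0nil; rewrite size_image; apply: eq_card0.
  by symmetry; apply: size0nil; rewrite size_image -eqT; apply: eq_card0.
exists (fun f => odflt x0 [pick x | g1 x != g2 (f x)]) => f f_bij.
case: pickP => [x /eqP //|eq_g]; case: neq_g; apply/seq_mset_bijP.
by exists f => // x; apply/eqP/negbFE/eq_g.
Qed.

Lemma msubset_size_eq (T : choiceType) (A B : {mset T}) :
  (A `<=` B)%mset -> size B <= size A -> A = B.
Proof.
move=> sAB; rewrite -{1}(msetBDKC sAB).
have -> : size (A `+` (B `\` A))%mset = size A + size (B `\` A)%mset.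
  rewrite -size_cat; apply: perm_size; apply/allP => a _ /=.
  by rewrite count_cat !count_mem_mset msetE2.
rewrite -{2}[size A]addn0 leq_add2l leqn0 size_mset_eq0 => /eqP BA0.
by rewrite -(msetBDKC sAB) BA0 msetD0.
Qed.

Lemma ordS_widen (n : nat) (i : 'I_n) :
  ordS (widen_ord (leqnSn n) i) = lift ord0 i.
Proof. by apply: val_inj; rewrite /= modn_small ?ltnS. Qed.

Lemma ordS_max (n : nat) : ordS (@ord_max n) = ord0.
Proof. by apply: val_inj; rewrite /= modnn. Qed.

Lemma cyclic_labelP (n : nat) (i : 'I_n.+1) :
  i = ord_max \/ exists j : 'I_n, i = widen_ord (leqnSn n) j.
Proof.
have [i_lt|i_ge] := ltnP i n; [right | left].
  by exists (Ordinal i_lt); apply: val_inj.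
by apply: val_inj; apply/eqP; rewrite eqn_leq i_ge -ltnS ltn_ord.
Qed.

(** * Symmetry and monotonicity of walk refinement *)

Section Colors.
Variable k : nat.
Local Notation chi m := (@walk_refinement k.+2 _ m).

Lemma walk_colorsP (m : nat) (G1 G2 : graph) (chi1 : G1 -> G1 -> color k.+2 m)
    (chi2 : G2 -> G2 -> color k.+2 m) u v w u' v' w' :
  walk_colors chi1 u v w = walk_colors chi2 u' v' w' <->
  forall i, i < k.+2 ->
    chi1 (nth u (u :: rcons w v) i) (nth u (u :: rcons w v) i.+1) =
    chi2 (nth u' (u' :: rcons w' v') i) (nth u' (u' :: rcons w' v') i.+1).
Proof.
split=> [eq_col i i_lt|eq_col].
  have := congr1 (fun t => tnth t (Ordinal i_lt)) eq_col.
  by rewrite !tnth_mktuple.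
by apply: eq_from_tnth => i; rewrite !tnth_mktuple; apply: eq_col.
Qed.

Lemma color_succP (m : nat) (G1 G2 : graph) (u v : G1) (u' v' : G2) :
  chi m.+1 u v = chi m.+1 u' v' <->
  exists2 f : k.+1.-tuple G1 -> k.+1.-tuple G2, bijective f &
    forall w, walk_colors (chi m) u v w = walk_colors (chi m) u' v' (f w).
Proof. exact: seq_mset_bijP. Qed.

Lemma nth_rev_walk (G : graph) (u v : G) (w : k.+1.-tuple G) (i : nat) :
  i <= k.+2 ->
  nth v (v :: rcons (rev_tuple w) u) i = nth u (u :: rcons w v) (k.+2 - i).
Proof.
have size_walk : size (u :: rcons w v) = k.+3.
  by rewrite /= size_rcons size_tuple.
move=> i_le; rewrite /= -rev_cons -rev_rcons nth_rev rcons_cons size_walk //.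
rewrite subSS.
by apply: set_nth_default; rewrite size_walk ltnS leq_subr.
Qed.

(** Reversing walks is a bijection; conjugating the matching of walks from $u$ to $v$ by it matches
    the walks from $v$ to $u$. *)
Lemma color_sym (m : nat) (G1 G2 : graph) (u v : G1) (u' v' : G2) :
  chi m u v = chi m u' v' -> chi m v u = chi m v' u'.
Proof.
elim: m u v u' v' => [|m IHm] u v u' v'.
  by rewrite /= /init_color !(eq_sym v, eq_sym v') !(adj_sym v, adj_sym v').
case/color_succP => f f_bij fE; apply/color_succP.
have rev_tupleK (G : graph) : involutive (@rev_tuple k.+1 G).
  by move=> w; apply: val_inj; rewrite /= revK.
exists (fun w => rev_tuple (f (rev_tuple w))).
  apply: (bij_comp (inv_bij (@rev_tupleK G2))).
  exact: bij_comp f_bij (inv_bij (@rev_tupleK G1)).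
move=> w; apply/walk_colorsP => i i_lt; have i_le := ltnW i_lt.
rewrite -{1 2}(rev_tupleK _ w).
rewrite !(nth_rev_walk _ _ (rev_tuple w), nth_rev_walk _ _ (f _)) //.
rewrite subSS; apply: IHm.
have /walk_colorsP/(_ (k.+1 - i)) := fE (rev_tuple w).
by rewrite ltnS leq_subr -subSn //; apply.
Qed.

Lemma nth_walk_last (G : graph) (u v : G) (w : k.+1.-tuple G) :
  nth u (u :: rcons w v) k.+2 = v.
Proof. by rewrite /= nth_rcons size_tuple ltnn eqxx. Qed.

Lemma nth_walk1 (G : graph) (u v : G) (w : k.+1.-tuple G) :
  nth u (u :: rcons w v) 1 = thead w.
Proof. by rewrite /= nth_rcons size_tuple /thead (tnth_nth u). Qed.

(** Consider the walk that stays at $u$ and moves to $v$ in its last step. As colors recognize equal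
    vertices, the matched walk stays at $u'$ and ends in a step to $v'$. Its first and last steps
    give the two equalities. *)
Lemma color_succ_refines_diag (m : nat) (G1 G2 : graph) :
  (forall (u v : G1) (u' v' : G2),
     chi m u v = chi m u' v' -> (u == v) = (u' == v')) ->
  forall (u v : G1) (u' v' : G2), chi m.+1 u v = chi m.+1 u' v' ->
  chi m u v = chi m u' v' /\ chi m u u = chi m u' u'.
Proof.
move=> diagP u v u' v' /color_succP [f _ /(_ (nseq_tuple k.+1 u)) fE].
move: {f fE}(f _) (fE) => w' /walk_colorsP eq_col.
have stay i : i <= k.+1 -> nth u (u :: rcons (nseq_tuple k.+1 u) v) i = u.
  rewrite -[u :: _]/(rcons (nseq k.+2 u) v) nth_rcons size_nseq ltnS => i_le.
  by rewrite i_le nth_nseq ltnS i_le.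
have stay' i : i <= k.+1 -> nth u' (u' :: rcons w' v') i = u'.
  elim: i => // i IHi i_lt; have i_le := ltnW i_lt; have := eq_col i i_le.
  by rewrite !stay ?IHi // => /diagP; rewrite eqxx => /esym/eqP.
split; last by have := eq_col 0 isT; rewrite !stay ?stay'.
by have := eq_col k.+1 (ltnSn _); rewrite !nth_walk_last stay ?stay'.
Qed.

Lemma color_diag (m : nat) (G1 G2 : graph) (u v : G1) (u' v' : G2) :
  chi m u v = chi m u' v' -> (u == v) = (u' == v').
Proof.
elim: m u v u' v' => [|m IHm] u v u' v'.
  by rewrite /= /init_color; case: eqP; case: eqP; do 2?case: adj.
by case/(color_succ_refines_diag IHm) => /IHm.
Qed.

Lemma color_refines_left (m : nat) (G1 G2 : graph) (u v : G1) (u' v' : G2) :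
  chi m.+1 u v = chi m.+1 u' v' -> chi m u u = chi m u' u'.
Proof. by case/(color_succ_refines_diag (@color_diag m G1 G2)). Qed.

Lemma color_refines (m n : nat) (G1 G2 : graph) (u v : G1) (u' v' : G2) :
  m <= n -> chi n u v = chi n u' v' -> chi m u v = chi m u' v'.
Proof.
move/subnK <-; elim: (n - m) => // d IHd.
by case/(color_succ_refines_diag (@color_diag _ G1 G2)) => /IHd.
Qed.

(** An initial color records exactly whether the two vertices coincide and, if not, whether they are
    adjacent. *)
Lemma pair_isoP (G1 G2 : graph) (a b : G1) (a' b' : G2) :
  pair_iso a b a' b' <-> init_color k a b = init_color k a' b'.
Proof.
rewrite /init_color; split=> [[h [<- <- h_inj h_mono]]|eq_col].
  have [aS bS] : a \in [set a; b] /\ b \in [set a; b].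
    by rewrite !inE !eqxx orbT.
  by rewrite (inj_in_eq h_inj) // h_mono.
exists (fun x => if x == a then a' else b').
have [eq_ab|neq_ab] := eqVneq a b.
  move: eq_col; rewrite eq_ab eqxx; case: eqVneq => [-> _|_]; last by case: adj.
  split=> [|||x y]; rewrite ?eqxx //.
    by move=> x y; rewrite !inE !orbb => /eqP-> /eqP->.
  by rewrite !inE !orbb => /eqP-> /eqP->; rewrite eqxx !adj_irrefl.
have neq_ab' : a' != b'.
  by move: eq_col; rewrite (negPf neq_ab); case: eqP => //; case: adj.
have adj_ab : adj a b = adj a' b'.
  by move: eq_col; rewrite (negPf neq_ab) (negPf neq_ab'); do 2!case: adj.
split; rewrite ?eqxx 1?eq_sym ?(negPf neq_ab) //; move=> x y.
all: rewrite !inE => /orP[] /eqP-> /orP[] /eqP->.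
all: rewrite ?eqxx ?(eq_sym b a) ?(negPf neq_ab) ?adj_irrefl //.
- by move/eqP; rewrite (negPf neq_ab').
- by move/eqP; rewrite eq_sym (negPf neq_ab').
by rewrite adj_sym -adj_ab adj_sym.
Qed.

(** * Colors of the pairs with a given first vertex *)

(** Each color $\chi(u,v)$ is repeated $|G|^k$ times, because both the game and the logic choose
    whole tuples, of which only the head $v$ is used here. *)
Definition head_colors (m : nat) (G : graph) (u : G) : {mset color k.+2 m} :=
  seq_mset [seq chi m u (thead w) | w : k.+1.-tuple G].

Lemma sum_head_colors (m : nat) (G : graph) (c : color k.+2 m) :
  \sum_(w : k.+1.-tuple G) head_colors m (thead w) c =
  #|G| ^ k * (#|G| ^ k * count_mem c [seq chi m p.1 p.2 | p : G * G]).
Proof.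
rewrite (sum_tuple_head k (fun u => head_colors m u c)); congr (_ * _).
have head_count (u : G) :
    head_colors m u c = #|G| ^ k * \sum_v (chi m u v == c).
  rewrite mset_seqE count_mem_image.
  rewrite -[RHS](@sum_tuple_head G k (fun v => chi m u v == c)).
  rewrite -sum1_card big_mkcond.
  by apply: eq_bigr => w _; rewrite inE; case: eqP.
under eq_bigr => u _ do rewrite head_count.
rewrite -big_distrr pair_bigA; congr (_ * _).
rewrite count_mem_image -sum1_card.
by rewrite [RHS]big_mkcond; apply: eq_bigr => p _; rewrite inE; case: eqP.
Qed.

(** Summing the inner multiplicities over the outer family counts each pair color $|G|^{2k}$ times,
    a common factor that cancels unless the graphs are empty. *)
Lemma eq_head_colors (m : nat) (G1 G2 : graph) :
  seq_mset [seq head_colors m (thead w) | w : k.+1.-tuple G1] =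
  seq_mset [seq head_colors m (thead w) | w : k.+1.-tuple G2] ->
  seq_mset [seq chi m p.1 p.2 | p : G1 * G1] =
  seq_mset [seq chi m p.1 p.2 | p : G2 * G2].
Proof.
case/seq_mset_bijP => f f_bij fE; have eqG : #|G1| = #|G2|.
  apply/eqP; rewrite -(@eqn_exp2r _ _ k.+1) // -!card_tuple.
  by rewrite (bij_eq_card f_bij).
apply/msetP => c; rewrite !mset_seqE.
have := sum_head_colors G2 c; rewrite (reindex f) /=; last exact: onW_bij.
under eq_bigr => w _ do rewrite -fE.
rewrite sum_head_colors eqG => /eqP.
have [G2_0 _|G2_gt0] := posnP #|G2|; last first.
  by rewrite !eqn_pmul2l ?expn_gt0 ?G2_gt0 // => /eqP.
have count0 (G : graph) :
    #|G| = 0 -> count_mem c [seq chi m p.1 p.2 | p : G * G] = 0.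
  move=> G0; apply/eqP; rewrite -leqn0 (leq_trans (count_size _ _)) //.
  by rewrite size_image card_prod G0.
by rewrite !count0 ?eqG.
Qed.

(** * Pebble positions as pairs of walks *)

Section Pebbles.
Variables G1 G2 : graph.

Definition walk_pair (a b : G1) (a' b' : G2) (w : seq G1) (w' : seq G2)
    (i : nat) : G1 * G2 :=
  (nth a (a :: rcons w b) i, nth a' (a' :: rcons w' b') i).

Lemma place_interior (P : position k.+2 G1 G2) a b a' b'
    (w : k.+1.-tuple G1) (w' : k.+1.-tuple G2) (l : 'I_k.+3) :
  interior l -> place P w w' l = Some (walk_pair a b a' b' w w' l).
Proof.
rewrite /place => l_int; rewrite l_int; case/andP: l_int.
case: l => [[|l] l_lt] //= _; rewrite ltnS => {}l_lt; apply: onth_zip.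
  by rewrite /= nth_rcons onthE (nth_map a) size_tuple ?l_lt.
by rewrite /= nth_rcons onthE (nth_map a') size_tuple ?l_lt.
Qed.

Lemma exterior (l : 'I_k.+3) : ~~ interior l -> (l == ord0) || (l == ord_max).
Proof.
rewrite /interior negb_and -!leqNgt leqn0 -!val_eqE /= => /orP[->//|le_l].
by rewrite [X in _ || X]eqn_leq le_l -ltnS ltn_ord orbT.
Qed.

(** The hypotheses on the ends are implications, so that [a], [a'] or [b], [b'] can be chosen freely
    when the end pebble is absent. *)
Lemma place_walk (P : position k.+2 G1 G2) a b a' b'
    (w : k.+1.-tuple G1) (w' : k.+1.-tuple G2) (l : 'I_k.+3) p :
  (forall q, P ord0 = Some q -> q = (a, a')) ->
  (forall q, P ord_max = Some q -> q = (b, b')) ->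
  place P w w' l = Some p -> p = walk_pair a b a' b' w w' l.
Proof.
move=> P0 Pmax; have [l_int|l_ext] := boolP (interior l).
  by rewrite (place_interior P a b a' b' w w' l_int) => -[].
rewrite /place (negPf l_ext); have /orP[/eqP->|/eqP->] := exterior l_ext.
  by move/P0.
by move/Pmax; rewrite /walk_pair !nth_walk_last.
Qed.

Lemma place_walk_total (P : position k.+2 G1 G2) a b a' b'
    (w : k.+1.-tuple G1) (w' : k.+1.-tuple G2) (l : 'I_k.+3) :
  P ord0 = Some (a, a') -> P ord_max = Some (b, b') ->
  place P w w' l = Some (walk_pair a b a' b' w w' l).
Proof.
move=> P0 Pmax; have [|l_ext] := boolP (interior l).
  exact: place_interior.
rewrite /place (negPf l_ext); have /orP[/eqP->|/eqP->] := exterior l_ext.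
  exact: P0.
by rewrite Pmax /walk_pair !nth_walk_last.
Qed.

(** This compares the pair of first components in [G1] with the pair of second components in [G2];
    [equivalent p p] thus says that the two vertices under one pebble pair look alike. *)
Definition equivalent (p q : G1 * G2) : Prop :=
  forall m, chi m p.1 q.1 = chi m p.2 q.2.

Lemma equivalent_sym p q : equivalent p q -> equivalent q p.
Proof. by move=> pq m; apply: color_sym. Qed.

Lemma equivalent_refl_left p q : equivalent p q -> equivalent p p.
Proof. by move=> pq m; apply: color_refines_left (pq m.+1). Qed.

(** There are finitely many quadruples of vertices. Each inequivalent one is separated at some
    stage, and by [color_refines] it remains separated at the maximum [M] of these stages. *)
Lemma stable_color :
  exists M, forall p q : G1 * G2,
    chi M p.1 q.1 = chi M p.2 q.2 -> equivalent p q.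
Proof.
have bound (pq : (G1 * G2) * (G1 * G2)) : exists m,
    chi m pq.1.1 pq.2.1 = chi m pq.1.2 pq.2.2 -> equivalent pq.1 pq.2.
  have [eqv|/not_all_ex_not [m neq]] := classic (equivalent pq.1 pq.2).
    by exists 0.
  by exists m.
have {bound} [F FP] := fin_all_exists bound.
exists (\max_pq F pq) => p q eq_col; apply: (FP (p, q)).
exact: color_refines (leq_bigmax _) eq_col.
Qed.

Definition balanced (P : position k.+2 G1 G2) : Prop :=
  (forall i p, P i = Some p -> equivalent p p) /\
  (forall i p q, P i = Some p -> P (ordS i) = Some q -> equivalent p q).

Lemma balanced_place (P : position k.+2 G1 G2) a b a' b'
    (w : k.+1.-tuple G1) (w' : k.+1.-tuple G2) :
  (forall q, P ord0 = Some q -> q = (a, a')) ->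
  (forall q, P ord_max = Some q -> q = (b, b')) ->
  equivalent (a, a') (b, b') ->
  (forall i, i < k.+2 -> equivalent (walk_pair a b a' b' w w' i)
                                    (walk_pair a b a' b' w w' i.+1)) ->
  balanced (place P w w').
Proof.
move=> P0 Pmax ends steps.
have cyc (i : 'I_k.+3) : equivalent (walk_pair a b a' b' w w' i)
                        (walk_pair a b a' b' w w' (ordS i)).
  have [->|[j ->]] := cyclic_labelP i; last first.
    by rewrite ordS_widen; apply: steps (ltn_ord j).
  rewrite ordS_max {1}/walk_pair !nth_walk_last.
  exact: equivalent_sym.
split=> [i p|i p q] /(place_walk P0 Pmax)->.
  exact: equivalent_refl_left (cyc i).
by move=> /(place_walk P0 Pmax)->.
Qed.

(** The surviving pebbles $i$, $i+1$ become the first and the last, which are consecutive in the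
    opposite order; hence the appeal to symmetry. *)
Lemma balanced_relabel (P : position k.+2 G1 G2) i :
  balanced P -> balanced (relabel P i).
Proof.
rewrite /relabel => -[refl_P step_P]; split=> [l p|l p q].
  by case: ifP => _; [|case: ifP => _ //]; apply: refl_P.
case: (l =P ord0) => [->|_]; first by [].
case: (l =P ord_max) => // ->; rewrite ordS_max eqxx => Pp Pq.
by apply: equivalent_sym; apply: step_P Pq Pp.
Qed.

(** * Equal colors: Duplicator survives and formulas agree *)

Section Duplicator.
Hypothesis eq_colors : forall m : nat,
  seq_mset [seq chi m p.1 p.2 | p : G1 * G1]
    = seq_mset [seq chi m p.1 p.2 | p : G2 * G2].

Lemma eq_card_vertices : #|G1| = #|G2|.
Proof.
have /seq_mset_bijP [h /bij_eq_card] := eq_colors 0.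
by rewrite !card_prod !mulnn => /eqP; rewrite eqn_exp2r // => /eqP.
Qed.

Lemma equivalent_walks p q : equivalent p q ->
  exists2 f : k.+1.-tuple G1 -> k.+1.-tuple G2, bijective f &
    forall (w : k.+1.-tuple G1) i,
    i < k.+2 -> equivalent (walk_pair p.1 q.1 p.2 q.2 w (f w) i)
                           (walk_pair p.1 q.1 p.2 q.2 w (f w) i.+1).
Proof.
have [M MP] := stable_color => /(_ M.+1)/color_succP [f f_bij fE].
exists f => // w i i_lt; apply: MP.
by have /walk_colorsP/(_ i i_lt) := fE w.
Qed.

(** A matching of all pairs by their stable colors maps the diagonal into the diagonal. *)
Lemma equivalent_vertices :
  exists2 g : G1 -> G2, injective g & forall u, equivalent (u, g u) (u, g u).
Proof.
have [M MP] := stable_color; have /seq_mset_bijP [h h_bij hE] := eq_colors M.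
have h_diag u : h (u, u) = ((h (u, u)).1, (h (u, u)).1).
  have := color_diag (hE (u, u)); rewrite eqxx => /esym/eqP.
  by case: (h _) => x y /= ->.
exists (fun u => (h (u, u)).1) => [u v eq_uv|u]; last first.
  by apply: MP; rewrite /= (hE (u, u)) h_diag.
have : h (u, u) = h (v, v) by rewrite h_diag eq_uv -h_diag.
by move/(bij_inj h_bij) => [].
Qed.

Lemma balanced_extension (P : position k.+2 G1 G2) : balanced P ->
  exists2 f : k.+1.-tuple G1 -> k.+1.-tuple G2, bijective f &
    forall w, balanced (place P w (f w)).
Proof.
move=> [refl_P step_P].
have ends p q : equivalent p q -> (forall p', P ord0 = Some p' -> p' = p) ->
    (forall q', P ord_max = Some q' -> q' = q) -> exists2 f, bijective f &
    forall w, balanced (place P w (f w)).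
  case: p q => a a' [b b'] pq P0 Pmax.
  have [f f_bij fE] := equivalent_walks pq; exists f => // w.
  by apply: (balanced_place P0 Pmax pq) => i; apply: fE.
(* If only one end carries a pebble, the other end is taken to be the same pair, which gives closed
   walks. *)
case P0: (P ord0) => [p|]; case Pmax: (P ord_max) => [q|].
- apply: (ends p q) => [|p'|q']; rewrite ?P0 ?Pmax; try by case.
  by apply: equivalent_sym; apply: (step_P ord_max); rewrite ?ordS_max.
- apply: (ends p p) => [|p'|q']; rewrite ?P0 ?Pmax; try by case.
  exact: refl_P P0.
- apply: (ends q q) => [|p'|q']; rewrite ?P0 ?Pmax; try by case.
  exact: refl_P Pmax.
(* With no pebble at the ends, w is read as a closed walk at its own first    *)
(* vertex whose first step is stationary.                                     *)
have [g g_inj gE] := equivalent_vertices.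
have {}walks u : exists f : k.+1.-tuple G1 -> k.+1.-tuple G2, bijective f /\
    forall (w : k.+1.-tuple G1) i, i < k.+2 ->
      equivalent (walk_pair u u (g u) (g u) w (f w) i)
                 (walk_pair u u (g u) (g u) w (f w) i.+1).
  by have [f] := equivalent_walks (gE u); exists f.
have {walks} [F FE] := fin_all_exists walks.
have headF w : thead (F (thead w) w) = g (thead w).
  have [_ /(_ w 0 isT 0)/color_diag] := FE (thead w).
  have -> : (walk_pair (thead w) (thead w) (g (thead w)) (g (thead w)) w
      (F (thead w) w) 1) = (thead w, thead (F (thead w) w)).
    by rewrite /walk_pair !nth_walk1.
  by rewrite eqxx => /esym/eqP.
(* By [headF] the head of the image determines that of [w], so injectivity reduces to that of a
   single [F u]. *)
exists (fun w => F (thead w) w).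
  apply: inj_card_bij; last by rewrite !card_tuple eq_card_vertices.
  move=> w w' eqF; have := congr1 (@thead _ _) eqF.
  rewrite !headF => /g_inj eq_h.
  by move: eqF; rewrite eq_h => /(bij_inj (proj1 (FE _))).
move=> w; apply: (balanced_place (a := thead w) (b := thead w)
    (a' := g (thead w)) (b' := g (thead w))).
- by rewrite P0.
- by rewrite Pmax.
- exact: gE.
by case: (FE (thead w)) => _; apply.
Qed.

Lemma spoiler_wins_unbalanced (P : position k.+2 G1 G2) :
  spoiler_wins P -> ~ balanced P.
Proof.
elim=> {}P.
  move=> [i [a [a' [b [b' [Pi PSi not_iso]]]]]] [_ step_P].
  by apply: not_iso; apply/pair_isoP; apply: step_P Pi PSi 0.
move=> P' reply move_P _ IH bal_P.
have /balanced_extension [f f_bij fE] : balanced P'.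
  by case: move_P bal_P => // i _; apply: balanced_relabel.
exact: IH f_bij (fE _).
Qed.

(** At a walk quantifier the free variables are read as pebbles on the ends of a walk. The bijection
    of [balanced_extension] preserves the truth of the body, since each conjunct only sees two
    consecutive pebbles; so the counts agree. *)
Lemma sat_balanced (phi : form k.+2) (a : assignment k.+2 G1)
    (a' : assignment k.+2 G2) :
  wf phi ->
  (forall x y, x \in fv phi -> y \in fv phi -> exists p q,
     [/\ a x = Some p.1, a y = Some q.1, a' x = Some p.2, a' y = Some q.2
       & equivalent p q]) ->
  sat a phi = sat a' phi.
Proof.
elim: phi a a' => [x y|x y|phi IH1 psi IH2|phi IH|j z psi IH] a a' /=.
- move=> _ /(_ x y); rewrite !inE !eqxx orbT => /(_ isT isT).
  by case=> p [q [-> -> -> -> pq]]; apply: color_diag (pq 0).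
- move=> _ /(_ x y); rewrite !inE !eqxx orbT => /(_ isT isT).
  case=> p [q [-> -> -> -> pq]]; have := pq 0; have := color_diag (pq 0).
  rewrite /= /init_color.
  have [->|_] := eqVneq p.1; have [->|_] := eqVneq p.2 => //.
    by rewrite !adj_irrefl.
  by do 2!case: adj.
- case/and3P=> wf1 wf2 _ aP; congr (_ && _).
    by apply: IH1 => // x y x_fv y_fv; apply: aP; rewrite inE ?x_fv ?y_fv.
  by apply: IH2 => // x y x_fv y_fv; apply: aP; rewrite inE ?x_fv ?y_fv orbT.
- by move=> wf_phi aP; congr (~~ _); apply: IH.
move=> /forallP wf_psi aP; congr (_ <= _).
set F := _ :\: _ in aP.
have ext_fv l i : z l \in fv (psi i) -> ~~ interior l -> z l \in F.
  move=> l_fv l_ext; rewrite inE; apply/andP.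
  split; last by apply/bigcupP; exists i.
  by apply: contra l_ext => /imsetP [l' l'_int /perm_inj ->].
(* Only free variables are turned into pebbles, as [aP] controls no other values. *)
pose P : position k.+2 G1 G2 := fun l => if z l \in F then
    if (a (z l), a' (z l)) is (Some u, Some u') then Some (u, u') else None
  else None.
have PE l p : P l = Some p ->
    [/\ z l \in F, a (z l) = Some p.1 & a' (z l) = Some p.2].
  rewrite /P; case: ifP => // _; case: (a _) => // u; case: (a' _) => // u'.
  by case=> <-.
have stepP l l' p q : P l = Some p -> P l' = Some q -> equivalent p q.
  move=> /PE [lF al a'l] /PE [l'F al' a'l'].
  have [p' [q' []]] := aP _ _ lF l'F; rewrite al al' a'l a'l'.
  case: p q p' q' {al a'l al' a'l'} => ? ? [? ?] [? ?] [? ?] /=.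
  by move=> [->] [->] [->] [->].
have /balanced_extension [f f_bij fE] : balanced P.
  by split=> *; apply: stepP; eassumption.
rewrite -(on_card_preimset (f := f)); last exact: onW_bij.
apply: eq_card => w; rewrite !inE; apply: eq_forallb => i.
have [wf_i fv_i] := andP (wf_psi i).
have [refl_w step_w] := fE w.
have assignE l : z l \in fv (psi i) -> exists p, [/\ place P w (f w) l = Some p,
    assign a z w (z l) = Some p.1 & assign a' z (f w) (z l) = Some p.2].
  move=> l_fv; rewrite /assign /place !permK; case: ifPn => [l_int|l_ext].
    case/andP: l_int; case: (l : nat) => // n _; rewrite ltnS => n_lt.
    exists (tnth w (Ordinal n_lt), tnth (f w) (Ordinal n_lt)).
    have onth_w : onth w n = Some (tnth w (Ordinal n_lt)).
      exact/(tnth_onth _ _ (Ordinal n_lt)).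
    have onth_fw : onth (f w) n = Some (tnth (f w) (Ordinal n_lt)).
      exact/(tnth_onth _ _ (Ordinal n_lt)).
    by split=> //; apply: onth_zip.
  have lF := ext_fv _ _ l_fv l_ext.
  have [p [_ [al _ a'l _ _]]] := aP _ _ lF lF.
  by exists p; rewrite /P lF al a'l; case: p {al a'l}.
apply: IH => // x y x_fv y_fv.
have [l x_l] : exists l, x = z l by exists ((z^-1)%g x); rewrite permKV.
have [l' y_l'] : exists l, y = z l by exists ((z^-1)%g y); rewrite permKV.
rewrite {}x_l {}y_l' in x_fv y_fv *.
have [p [Pl al a'l]] := assignE _ x_fv.
have [q [Pl' al' a'l']] := assignE _ y_fv.
exists p, q; split=> //.
have := subsetP fv_i _ x_fv; have := subsetP fv_i _ y_fv.
rewrite !inE !(inj_eq perm_inj) -ordS_widen.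
move=> /orP[] /eqP l'E /orP[] /eqP lE; rewrite lE in Pl *; rewrite l'E in Pl' *.
- have [<-] : Some p = Some q by rewrite -Pl -Pl'.
  exact: refl_w Pl.
- by apply: equivalent_sym; apply: step_w Pl' Pl.
- exact: step_w Pl Pl'.
have [<-] : Some p = Some q by rewrite -Pl -Pl'.
exact: refl_w Pl.
Qed.

End Duplicator.

(** * Different colors: Spoiler's strategy *)

Lemma place_second (P : position k.+2 G1 G2)
    (w : k.+1.-tuple G1) (w' : k.+1.-tuple G2) :
  place P w w' (lift ord0 ord0) = Some (thead w, thead w').
Proof.
rewrite (place_interior P (thead w) (thead w) (thead w') (thead w')) //.
by rewrite /walk_pair !nth_walk1.
Qed.

(** Spoiler keeps the two pebbles as ends and answers with a walk whose colors are mismatched; some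
    step of it differs at the previous stage and lies on consecutive labels. *)
Lemma spoiler_wins_color (m : nat) (P : position k.+2 G1 G2) i p q :
  #|G1| = #|G2| -> P i = Some p -> P (ordS i) = Some q ->
  chi m p.1 q.1 <> chi m p.2 q.2 -> spoiler_wins P.
Proof.
move=> eqG; elim: m P i p q => [|m IHm] P i [a a'] [b b'] Pi PSi neq_col.
  by apply: Won; exists i, a, a', b, b'; split=> // /pair_isoP.
have [|reply replyP] := bijection_reply _ neq_col.
  by rewrite !card_tuple eqG.
have move_P : relabel_move P (relabel P i) by apply: Relabel; rewrite Pi.
apply: (@Round k.+2 G1 G2 _ _ reply move_P _) => f /replyP.
move: (reply f) (f _) => w w' neq_walk.
have P0 : relabel P i ord0 = Some (a, a') := Pi.
have Pmax : relabel P i ord_max = Some (b, b') by rewrite /relabel eqxx.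
have placeE := place_walk_total w w' _ P0 Pmax.
apply: NNPP => not_win; apply: neq_walk; apply/walk_colorsP => j j_lt.
apply: NNPP => neq_col'; apply: not_win.
pose l := widen_ord (leqnSn _) (Ordinal j_lt).
by apply: (IHm _ l _ _ (placeE l) (placeE (ordS l))); rewrite ordS_widen.
Qed.

Lemma spoiler_wins_start (m : nat) : #|G1| = #|G2| ->
  seq_mset [seq head_colors m (thead w) | w : k.+1.-tuple G1] <>
  seq_mset [seq head_colors m (thead w) | w : k.+1.-tuple G2] ->
  @spoiler_wins k.+2 G1 G2 (fun=> None).
Proof.
move=> eqG; have eq_tuple : #|{: k.+1.-tuple G1}| = #|{: k.+1.-tuple G2}|.
  by rewrite !card_tuple eqG.
move=> /(bijection_reply eq_tuple) [reply replyP].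
have move0 : @relabel_move k.+2 G1 G2 (fun=> None) (fun=> None).
  exact: NoPebbles.
apply: (@Round k.+2 G1 G2 _ _ reply move0 _) => f /replyP.
move: (reply f) (f _) => w w' /(bijection_reply eq_tuple) [reply' reply'P].
set P := @place k.+2 G1 G2 (fun=> None) w w'.
have P1 : P (lift ord0 ord0) = Some (thead w, thead w') := place_second _ w w'.
have move_P : relabel_move P (relabel P (lift ord0 ord0)).
  by apply: Relabel; rewrite P1.
apply: (@Round k.+2 G1 G2 _ _ reply' move_P _) => f' /reply'P.
move: (reply' f') (f' _) => v v' neq_col.
(* The pebble on $u$ was relabeled to label 0, and the head $v$ of the second tuple lies at label
   1. *)
refine (@spoiler_wins_color m _ ord0 (thead w, thead w') (thead v, thead v')
          eqG P1 _ neq_col).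
have -> : ordS ord0 = lift ord0 ord0 :> 'I_k.+3 by apply: val_inj.
exact: place_second.
Qed.

End Pebbles.

(** * Formulas that define colors *)

Section Formulas.
Implicit Types (x y : 'I_k.+3) (z : 'S_k.+3).

Definition step_vars z (i : 'I_k.+2) : {set 'I_k.+3} :=
  [set z (widen_ord (leqnSn _) i); z (lift ord0 i)].

Definition true_form x : form k.+2 := Not (And (Eq x x) (Not (Eq x x))).

(** This selects a quantified variable among the two variables of step $i$, so that a trivial
    conjunct adds no free variable to the quantified formula. *)
Definition interior_label (i : 'I_k.+2) : 'I_k.+3 :=
  if i == ord0 then lift ord0 ord0 else widen_ord (leqnSn _) i.

(* Holds if and only if D is the multiset of the values g w, provided that    *)
(* each family Psi t says that g w = t.  Bounding the number of all tuples by *)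
(* the size of D turns the lower bounds on multiplicities into equalities.    *)
Definition mset_form (T : choiceType) z (D : {mset T})
    (Psi : T -> 'I_k.+2 -> form k.+2) : form k.+2 :=
  foldr (fun t phi => And (Walk (D t) z (Psi t)) phi)
    (Not (Walk (size D).+1 z (fun i => true_form (z (interior_label i))))) D.

Lemma sat_true_form (G : graph) (a : assignment k.+2 G) x : sat a (true_form x).
Proof. by rewrite /= andbN. Qed.

Lemma sat_mset_form (T : choiceType) z (D : {mset T}) Psi (G : graph)
    (a : assignment k.+2 G) (g : k.+1.-tuple G -> T) :
  (forall t w, [forall i, sat (assign a z w) (Psi t i)] = (g w == t)) ->
  sat a (mset_form z D Psi) = (seq_mset [seq g w | w : k.+1.-tuple G] == D).
Proof.
move=> PsiP; set A := seq_mset _.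
have -> : sat a (mset_form z D Psi) =
    all (fun t => D t <= A t) D && (size A <= size D).
  rewrite /mset_form; elim: {2 3}(D : seq T) => /= [|t s ->]; last first.
    rewrite andbA; congr (_ && _ && _); rewrite mset_seqE count_mem_image.
    by congr (_ <= _); apply: eq_card => w; rewrite !inE PsiP.
  rewrite -leqNgt (perm_size (perm_eq_seq_mset _)) size_image; congr (_ <= _).
  apply: eq_card => w; rewrite !inE; apply/forallP => i.
  exact: sat_true_form.
apply/andP/eqP => [[/allP sDA leA]|->]; last first.
  by split=> //; apply/allP.
apply/esym/msubset_size_eq => //; apply/msubsetP => t.
have [/sDA //|] := boolP (t \in D).
by rewrite in_mset -eqn0Ngt => /eqP ->.
Qed.

Definition interior_vars z : {set 'I_k.+3} :=
  [set z i | i in @interior k.+2].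

Lemma wf_mset_form (T : choiceType) z (D : {mset T}) Psi (S : {set 'I_k.+3}) :
  #|S| <= 2 ->
  (forall t i, wf (Psi t i) && (fv (Psi t i) \subset step_vars z i)) ->
  (forall t i, fv (Psi t i) \subset S :|: interior_vars z) ->
  wf (mset_form z D Psi) && (fv (mset_form z D Psi) \subset S).
Proof.
move=> S_le wf_Psi fv_Psi; rewrite /mset_form.
elim: {2 4}(D : seq T) => /= [|t s].
  apply/andP; split.
    apply/forallP => i; rewrite !setUid cards1 sub1set /=.
    rewrite /interior_label; case: eqP => [->|_]; rewrite !inE eqxx ?orbT //.
  apply/subsetP => x; rewrite inE => /andP[/negP x_int /bigcupP[i _]].
  rewrite !inE !orbb => /eqP xE; case: x_int; rewrite xE; apply: imset_f.
  rewrite /interior_label; case: eqP => [_|/eqP]; first by [].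
  by rewrite -val_eqE -lt0n unfold_in /interior /= => ->; rewrite ltn_ord.
case/andP=> wf_s fv_s.
have fv_t : fv (Walk (D t) z (Psi t)) \subset S.
  rewrite /= subDset; apply/bigcupsP => i _.
  by rewrite setUC.
have fv_ts : fv (Walk (D t) z (Psi t)) :|: fv (foldr (fun t phi =>
    And (Walk (D t) z (Psi t)) phi) (Not (Walk (size D).+1 z
    (fun i => true_form (z (interior_label i))))) s) \subset S.
  by rewrite subUset fv_t.
rewrite fv_ts wf_s andbT /= (leq_trans (subset_leq_card fv_ts)) // andbT.
by apply/forallP => i; apply: wf_Psi.
Qed.

Definition ends_perm x y : 'S_k.+3 :=
  (tperm ord0 x * tperm (tperm ord0 x ord_max) y)%g.

Lemma ends_permP x y : x != y ->
  ends_perm x y ord0 = x /\ ends_perm x y ord_max = y.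
Proof.
move=> neq_xy; rewrite /ends_perm !permM tpermL; split; last first.
  exact: tpermL.
have : tperm ord0 x ord0 != tperm ord0 x ord_max by rewrite (inj_eq perm_inj).
by rewrite tpermL => neq_x; apply: tpermD; rewrite eq_sym.
Qed.

(** The [k.+3] variables suffice because each conjunct concerns two of them and may requantify all
    others. Integers other than the three initial colors get a contradiction. *)
Fixpoint color_form (m : nat) :
    color k.+2 m -> 'I_k.+3 -> 'I_k.+3 -> form k.+2 :=
  match m with
  | 0 => fun c x y =>
      if c == (-1)%R then Eq x y
      else if c == 1%R then Adj x y
      else if c == 0%R then And (Not (Eq x y)) (Not (Adj x y))
      else And (Eq x y) (Not (Eq x y))
  | m'.+1 => fun C x y => let z := ends_perm x y in
      mset_form z C (fun t i =>
        color_form (tnth t i) (z (widen_ord (leqnSn _) i)) (z (lift ord0 i)))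
  end.

Lemma exterior_or_interior z l (x y : 'I_k.+3) :
  z ord0 = x -> z ord_max = y -> z l \in [set x; y] :|: interior_vars z.
Proof.
move=> <- <-; rewrite in_setU; have [l_int|/exterior] := boolP (interior l).
  by rewrite imset_f ?orbT.
by case/orP => /eqP->; rewrite !inE eqxx ?orbT.
Qed.

Lemma wf_color_form (m : nat) (c : color k.+2 m) x y : x != y ->
  wf (color_form c x y) && (fv (color_form c x y) \subset [set x; y]).
Proof.
elim: m c x y => [|m IHm] c x y neq_xy.
  by rewrite /=; do 3?case: ifP => _ /=; rewrite ?setUid ?subxx ?cards2 ?neq_xy.
have [z0 zmax] := ends_permP neq_xy; rewrite /=.
have wf_step (t : k.+2.-tuple (color k.+2 m)) i :=
  IHm (tnth t i) (ends_perm x y (widen_ord (leqnSn _) i))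
    (ends_perm x y (lift ord0 i)).
have neq_step (i : 'I_k.+2) :
    ends_perm x y (widen_ord (leqnSn _) i) != ends_perm x y (lift ord0 i).
  by rewrite (inj_eq perm_inj) -val_eqE /= neq_ltn leqnn.
apply: wf_mset_form; first by rewrite cards2 neq_xy.
  by move=> t i; apply: wf_step.
move=> t i; have /andP[_ /subset_trans] := wf_step t i (neq_step i); apply.
by apply/subsetP => _ /set2P[] ->; apply: exterior_or_interior.
Qed.

Lemma assign_walk (G : graph) (a : assignment k.+2 G) z u v
    (w : k.+1.-tuple G) l :
  a (z ord0) = Some u -> a (z ord_max) = Some v ->
  assign a z w (z l) = Some (nth u (u :: rcons w v) l).
Proof.
move=> a0 amax; rewrite /assign permK; have [|l_ext] := boolP (interior l).
  case/andP; case: l => [[|l] l_lt] //= _; rewrite ltnS => {}l_lt.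
  by rewrite onthE (nth_map u) ?size_tuple // nth_rcons size_tuple l_lt.
case/orP: (exterior l_ext) => /eqP->; first exact: a0.
by rewrite nth_walk_last.
Qed.

Lemma sat_init_color_form (c : color k.+2 0) x y (G : graph)
    (a : assignment k.+2 G) u v : a x = Some u -> a y = Some v ->
  sat a (color_form c x y) = (init_color k.+2 u v == c).
Proof.
move=> ax ay; rewrite /= /init_color.
have [->|neqN1] := eqVneq c (-1)%R; last have [->|neq1] := eqVneq c 1%R;
  last have [->|neq0] := eqVneq c 0%R; rewrite /= ax ay.
all: case: (eqVneq u v) => [eq_uv|_]; rewrite ?eq_uv ?adj_irrefl ?andbN //.
all: try by case: (adj u v).
all: by try case: ifP => _; rewrite eq_sym; apply/esym; apply: negPf.
Qed.

Lemma sat_color_form (m : nat) (c : color k.+2 m) x y (G : graph)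
    (a : assignment k.+2 G) u v : x != y -> a x = Some u -> a y = Some v ->
  sat a (color_form c x y) = (chi m u v == c).
Proof.
elim: m c x y a u v => [|m IHm] c x y a u v neq_xy ax ay.
  exact: sat_init_color_form.
have [z0 zmax] := ends_permP neq_xy; rewrite /=.
apply: sat_mset_form => t w; rewrite eqEtuple; apply: eq_forallb => i.
rewrite tnth_mktuple; apply: IHm.
- by rewrite (inj_eq perm_inj) -val_eqE /= neq_ltn leqnn.
- by rewrite (@assign_walk _ _ _ u v) ?z0 ?zmax.
by rewrite (@assign_walk _ _ _ u v) ?z0 ?zmax.
Qed.

(** Only the first conjunct, which may use $z_1$ and $z_2$, carries content; the others are
    tautologies in quantified variables. *)
Definition head_form (T : choiceType) z (D : {mset T}) (Phi : T -> form k.+2) :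
    form k.+2 :=
  mset_form z D (fun t i =>
    if i == ord0 then Phi t else true_form (z (widen_ord (leqnSn _) i))).

Lemma sat_head_form (T : choiceType) z (D : {mset T}) Phi (G : graph)
    (a : assignment k.+2 G) (g : G -> T) :
  (forall t w, sat (assign a z w) (Phi t) = (g (thead w) == t)) ->
  sat a (head_form z D Phi) =
    (seq_mset [seq g (thead w) | w : k.+1.-tuple G] == D).
Proof.
move=> PhiP; apply: sat_mset_form => t w; rewrite -PhiP.
apply/forallP/idP => [/(_ ord0) //|sat_t i].
by case: ifP => // _; apply: sat_true_form.
Qed.

Lemma wf_head_form (T : choiceType) z (D : {mset T}) Phi (S : {set 'I_k.+3}) :
  #|S| <= 2 -> (forall t, wf (Phi t)) ->
  (forall t, fv (Phi t) \subset step_vars z ord0) ->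
  (forall t, fv (Phi t) \subset S :|: interior_vars z) ->
  wf (head_form z D Phi) && (fv (head_form z D Phi) \subset S).
Proof.
move=> S_le wf_Phi step_Phi fv_Phi; apply: wf_mset_form => // t i.
  case: eqP => [->|_]; first by rewrite wf_Phi step_Phi.
  by rewrite /= !setUid cards1 sub1set !inE eqxx.
case: eqP => [_|/eqP i_neq0]; first exact: fv_Phi.
rewrite /= !setUid sub1set in_setU imset_f ?orbT // unfold_in.
by move: i_neq0; rewrite -val_eqE -lt0n /interior /= => ->; rewrite ltn_ord.
Qed.

Definition second : 'I_k.+3 := lift ord0 ord0.

Lemma assign_second (G : graph) (a : assignment k.+2 G) z (w : k.+1.-tuple G) :
  assign a z w (z second) = Some (thead w).
Proof. by rewrite /assign permK /=; apply/(tnth_onth _ _ ord0). Qed.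

Definition neighbor_form (m : nat) (N : {mset color k.+2 m}) x : form k.+2 :=
  let z := tperm ord0 x in
  head_form z N (fun c => color_form c x (z second)).

Lemma tperm_second_neq x : x != tperm ord0 x second.
Proof. by rewrite -{1}(tpermL ord0 x) (inj_eq perm_inj). Qed.

Lemma wf_neighbor_form (m : nat) (N : {mset color k.+2 m}) x :
  wf (neighbor_form N x) && (fv (neighbor_form N x) \subset [set x]).
Proof.
have wf_c (c : color k.+2 m) := wf_color_form c (tperm_second_neq x).
have stepE : step_vars (tperm ord0 x) ord0 = [set x; tperm ord0 x second].
  rewrite /step_vars; have -> : widen_ord (leqnSn k.+2) ord0 = ord0.
    exact: val_inj.
  by rewrite tpermL.
apply: wf_head_form; rewrite ?cards1 ?stepE // => c; try by case/andP: (wf_c c).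
have /andP[_ /subset_trans] := wf_c c; apply.
by rewrite setUSS // sub1set imset_f.
Qed.

Lemma sat_neighbor_form (m : nat) (N : {mset color k.+2 m}) x (G : graph)
    (a : assignment k.+2 G) u :
  a x = Some u -> sat a (neighbor_form N x) = (head_colors m u == N).
Proof.
move=> ax; apply: (@sat_head_form _ _ _ _ _ _ (chi m u)) => c w.
apply: sat_color_form (tperm_second_neq x) _ (assign_second _ _ _).
by rewrite -{2}(tpermL ord0 x) /assign permK /= tpermL.
Qed.

(** The variable [second] holds $u$; inside [neighbor_form] the transposition makes [ord0] the
    variable of $v$. *)
Definition graph_form (m : nat) (D : {mset {mset color k.+2 m}}) : form k.+2 :=
  head_form 1%g D (fun N => neighbor_form N second).

Lemma sentence_graph_form (m : nat) (D : {mset {mset color k.+2 m}}) :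
  sentence (graph_form D).
Proof.
rewrite /sentence -subset0.
have wf_N (N : {mset color k.+2 m}) := wf_neighbor_form N second.
apply: wf_head_form; rewrite ?cards0 // => N; have /andP[] := wf_N N => //.
  move=> _ /subset_trans; apply.
  by rewrite sub1set /step_vars !perm1 !inE eqxx orbT.
move=> _ /subset_trans; apply; rewrite set0U sub1set -[second]perm1.
exact: imset_f.
Qed.

Lemma holds_graph_form (m : nat) (D : {mset {mset color k.+2 m}}) (G : graph) :
  holds G (graph_form D) =
  (seq_mset [seq head_colors m (thead w) | w : k.+1.-tuple G] == D).
Proof.
apply: sat_head_form => N w; apply: sat_neighbor_form.
by rewrite -[second](perm1) assign_second.
Qed.

End Formulas.

(** * The equivalences *)

Lemma distinguishes_contra (G1 G2 : graph) :
  ~ refinement_distinguishes k.+2 G1 G2 -> forall m : nat,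
  seq_mset [seq chi m p.1 p.2 | p : G1 * G1]
    = seq_mset [seq chi m p.1 p.2 | p : G2 * G2].
Proof. by move=> not_R m; apply: NNPP => neq; apply: not_R; exists m. Qed.

Lemma refinement_logic (G1 G2 : graph) :
  refinement_distinguishes k.+2 G1 G2 <-> logic_distinguishes k.+2 G1 G2.
Proof.
split=> [[m neq_col]|[phi /andP[wf_phi /eqP fv0] neq_phi]].
  pose D := seq_mset [seq head_colors m (thead w) | w : k.+1.-tuple G1].
  exists (graph_form D); first exact: sentence_graph_form.
  rewrite !holds_graph_form eqxx => /esym/eqP eq_D.
  by apply: neq_col; apply: eq_head_colors.
apply: NNPP => /distinguishes_contra eq_col; apply: neq_phi.
by apply: (sat_balanced eq_col) => // x y; rewrite fv0 inE.
Qed.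

Lemma refinement_game (G1 G2 : graph) :
  refinement_distinguishes k.+2 G1 G2 <->
  spoiler_has_winning_strategy k.+2 G1 G2.
Proof.
split=> [[m neq_col]|spoiler].
  have [eqG|/eqP] := eqVneq #|G1| #|G2|; [right | by left].
  apply: (spoiler_wins_start (m := m)) => // eq_D.
  by apply: neq_col; apply: eq_head_colors.
apply: NNPP => /distinguishes_contra eq_col.
case: spoiler => [|/(spoiler_wins_unbalanced eq_col)]; last by apply; split.
by apply; apply: eq_card_vertices eq_col.
Qed.

End Colors.

Theorem theorem19 (k : nat) (hk : 2 <= k) (G1 G2 : graph) :
  (refinement_distinguishes k G1 G2 <-> logic_distinguishes k G1 G2) /\
  (logic_distinguishes k G1 G2 <-> spoiler_has_winning_strategy k G1 G2).
Proof.
case: k hk => [|[|k]] // _; split; first exact: refinement_logic.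
by rewrite -refinement_logic; apply: refinement_game.
Qed.
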